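(* Let $\mathscr{A}=\{A_1,\ldots,A_r\}$ be an irreducible set of real $m\times m$ matrices (the degenerate case $m=1$, $\mathscr{A}=\{0\}$ being excluded), let $\rho$ be its joint spectral radius, let $\|\cdot\|_0$ be a norm on $\mathbb{R}^m$, let $e\in\mathbb{R}^m$ satisfy $\|e\|_0=1$, let $0<\lambda^-\le\lambda^+<1$, and let $\lambda_n\in[\lambda^-,\lambda^+]$, $n=0,1,2,\ldots$, be arbitrary. Let the norms $\|\cdot\|_n$ and the numbers $\rho_n^{+},\rho_n^{-},\gamma_n$ be produced by the linear relaxation procedure. Then the sequences $\{\rho_n^+\}$ and $\{\rho_n^-\}$ converge, their limits coincide and equal the joint spectral radius of $\mathscr{A}$, $$\lim_{n\to\infty}\rho_n^+=\lim_{n\to\infty}\rho_n^-=\rho,$$ and the norms $\|\cdot\|_n$ converge pointwise on $\mathbb{R}^m$ to a norm $\|\cdot\|^*$ which is a Barabanov norm for $\mathscr{A}$.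
   Context: A matrix set $\mathscr{A}=\{A_1,\ldots,A_r\}$ is irreducible if the matrices from $\mathscr{A}$ have no common invariant subspaces except $\{0\}$ and $\mathbb{R}^m$. Its joint spectral radius is $\rho=\rho(\mathscr{A})=\limsup_{n\to\infty}\left(\max_{1\le i_1,\ldots,i_n\le r}\|A_{i_n}\cdots A_{i_2}A_{i_1}\|\right)^{1/n}$, where $\|\cdot\|$ is the matrix norm induced by any norm on $\mathbb{R}^m$ (the value does not depend on the norm). A Barabanov norm for $\mathscr{A}$ is a norm $\|\cdot\|$ on $\mathbb{R}^m$ such that $\max_i\|A_ix\|=\rho\|x\|$ for all $x\in\mathbb{R}^m$. The linear relaxation procedure: for $n=0,1,2,\ldots$, given the norm $\|\cdot\|_n$, set $$\rho_n^+=\max_{x\ne0}\frac{\max_i\|A_ix\|_n}{\|x\|_n},\quad \rho_n^-=\min_{x\ne0}\frac{\max_i\|A_ix\|_n}{\|x\|_n},\quad \gamma_n=\max_i\|A_ie\|_n,$$ and define the norm $\|x\|_{n+1}=\lambda_n\|x\|_n+(1-\lambda_n)\gamma_n^{-1}\max_i\|A_ix\|_n$. *)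

(* Defs.v *)
From HB Require Import structures.
From mathcomp Require Import all_boot all_order all_algebra.
From mathcomp Require Import all_classical all_reals all_analysis.

Set Implicit Arguments.
Unset Strict Implicit.
Unset Printing Implicit Defensive.

Import Order.TTheory GRing.Theory Num.Theory.
Import numFieldNormedType.Exports.

Local Open Scope classical_set_scope.
Local Open Scope ring_scope.

(* Norms are plain functions rather than a normed-module structure on the
   space, because the procedure handles a whole sequence of them at once. *)
Definition is_norm (R : realType) (m : nat) (N : 'cV[R]_m -> R) : Prop :=
  [/\ forall x, x != 0 -> 0 < N x,
      forall (a : R) x, N (a *: x) = `|a| * N x
    & forall x y, N (x + y) <= N x + N y].

Definition irreducible_family (R : realType) (m r : nat)
    (A : 'I_r -> 'M[R]_m) : Prop :=
  forall V : {vspace 'cV[R]_m},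
    (forall i x, x \in V -> A i *m x \in V) -> V = 0%VS \/ V = fullv.

(* The maximum of the numbers N (A_i x).  The default value 0 of the iterated
   maximum is harmless when N is a norm, since all these numbers are then
   nonnegative. *)
Definition max_image (R : realType) (m r : nat) (A : 'I_r -> 'M[R]_m)
    (N : 'cV[R]_m -> R) (x : 'cV[R]_m) : R :=
  \big[Num.max/0]_(i < r) N (A i *m x).

Definition opnorm (R : realType) (m : nat) (N : 'cV[R]_m -> R)
    (M : 'M[R]_m) : R :=
  sup [set N (M *m x) / N x | x in [set x | x != 0]].

(* For w = (i_1, ..., i_n) this is A_{i_n} ... A_{i_2} A_{i_1}. *)
Definition word_prod (R : realType) (m r : nat) (A : 'I_r -> 'M[R]_m)
    (w : seq 'I_r) : 'M[R]_m :=
  foldl (fun M i => A i *m M) 1%:M w.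

(* The joint spectral radius, computed with the matrix norm induced by N. *)
Definition jsr (R : realType) (m r : nat) (N : 'cV[R]_m -> R)
    (A : 'I_r -> 'M[R]_m) : R :=
  limn_sup (fun n : nat =>
    (\big[Num.max/0]_(w : n.-tuple 'I_r) opnorm N (word_prod A w))
      `^ (n%:R^-1)).

Definition is_barabanov (R : realType) (m r : nat) (A : 'I_r -> 'M[R]_m)
    (rho : R) (N : 'cV[R]_m -> R) : Prop :=
  is_norm N /\ forall x, max_image A N x = rho * N x.

(* For a norm N on a nonzero space the supremum and the infimum below are a
   maximum and a minimum, by compactness of the unit sphere. *)
Definition rho_plus (R : realType) (m r : nat) (A : 'I_r -> 'M[R]_m)
    (N : 'cV[R]_m -> R) : R :=
  sup [set max_image A N x / N x | x in [set x | x != 0]].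

Definition rho_minus (R : realType) (m r : nat) (A : 'I_r -> 'M[R]_m)
    (N : 'cV[R]_m -> R) : R :=
  inf [set max_image A N x / N x | x in [set x | x != 0]].

Fixpoint relax (R : realType) (m r : nat) (A : 'I_r -> 'M[R]_m)
    (e : 'cV[R]_m) (lam : nat -> R) (N0 : 'cV[R]_m -> R) (n : nat)
    : 'cV[R]_m -> R :=
  if n is k.+1 then
    let Nk := relax A e lam N0 k in
    let gamma := max_image A Nk e in
    fun x => lam k * Nk x + (1 - lam k) * gamma^-1 * max_image A Nk x
  else N0.

(* Main.v *)
Require Import Defs.
From HB Require Import structures.
From mathcomp Require Import all_boot all_order all_algebra.
From mathcomp Require Import all_classical all_reals all_analysis.
From mathcomp Require Import ring lra.

Set Implicit Arguments.
Unset Strict Implicit.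
Unset Printing Implicit Defensive.

Import Order.TTheory GRing.Theory Num.Theory.
Import numFieldNormedType.Exports.

Local Open Scope classical_set_scope.
Local Open Scope ring_scope.

(* Write F N for max_image A N, and N_n for the n-th norm.  One relaxation step
   cannot increase rho_plus nor decrease rho_minus, so rho_plus(N_n) decreases
   to some p and rho_minus(N_n) increases to some q <= p.  By irreducibility
   and compactness the N_n, which satisfy F N_n <= K N_n with a common K, have
   uniformly bounded eccentricity.  If q < p, then, n being large, a vector x nearly
   attaining rho_plus(N_(n+k)) nearly attains rho_plus(N_j) for all j between
   n and n+k, and likewise y for rho_minus; hence N_j x / N_j y grows by a
   factor t > 1 at each of these k steps, which contradicts the bounded
   eccentricity for k large.  So p = q, any limit point Q of the norms satisfies
   F Q = p Q, and the distortion between N_n and Q does not increase with n,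
   whence N_n converges to Q.  Finally F Q = p Q yields, for every n, a product
   of n matrices that scales Q by exactly p^n at a given vector, while none
   scales it by more, so p is the joint spectral radius. *)

(** * Limits along ultrafilters on [nat] *)

(** The image of [U] has a cluster point in the compact interval [[- C, C]], and it converges there
    because an ultrafilter contains each set or its complement. *)
Lemma ultra_bounded_cvg (R : realType) (U : set_system nat)
    (UU : UltraFilter U) (u : nat -> R) (C : R) :
  (forall n, `|u n| <= C) -> exists l : R, u n @[n --> U] --> l.
Proof.
move=> uC; have PU := @ultra_proper _ _ UU.
have uUC : fmap u U `[- C, C]%classic.
  by apply: (@filterE _ U) => n; rewrite /= in_itv /= -ler_norml.
have [l [_ ul]] := segment_compact (fmap_proper_filter u PU) uUC.
exists l => V Vl.
have [//|UnV] := in_ultra_setVsetC (u @^-1` V) UU.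
have [y [/= nVy Vy]] : (~` V) `&` V !=set0 by exact: ul.
by [].
Qed.

(** Refining [\oo] keeps every ordinary limit valid along [U]; such a [U] then selects limits at all
    vectors at once, in place of an extraction of subsequences. *)
Lemma exists_ultra_eventually :
  exists U : set_system nat, UltraFilter U /\ \oo `<=` U.
Proof. exact: ultraFilterLemma. Qed.

(** * Seminorms and compactness of the unit sphere *)

(** Limits of norms may lose definiteness, hence this weaker notion; nonnegativity follows from the
    two clauses. *)
Definition is_seminorm (R : realType) (m : nat) (N : 'cV[R]_m -> R) : Prop :=
  (forall (a : R) x, N (a *: x) = `|a| * N x)
  /\ (forall x y, N (x + y) <= N x + N y).

Definition l1norm (R : realType) (m : nat) (x : 'cV[R]_m) : R :=
  \sum_i `|x i ord0|.

Lemma norm_seminorm (R : realType) (m : nat) (N : 'cV[R]_m -> R) :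
  is_norm N -> is_seminorm N.
Proof. by case. Qed.

Lemma seminorm0 (R : realType) (m : nat) (N : 'cV[R]_m -> R) :
  is_seminorm N -> N 0 = 0.
Proof. by case=> NZ _; rewrite -(scale0r 0) NZ normr0 mul0r. Qed.

Lemma seminormN (R : realType) (m : nat) (N : 'cV[R]_m -> R) x :
  is_seminorm N -> N (- x) = N x.
Proof. by case=> NZ _; rewrite -scaleN1r NZ normrN1 mul1r. Qed.

Lemma seminorm_ge0 (R : realType) (m : nat) (N : 'cV[R]_m -> R) x :
  is_seminorm N -> 0 <= N x.
Proof.
move=> sN; have := sN.2 x (- x).
by rewrite subrr seminorm0 // seminormN // -mulr2n pmulrn_lge0.
Qed.

Lemma seminorm_distB (R : realType) (m : nat) (N : 'cV[R]_m -> R) x y :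
  is_seminorm N -> `|N x - N y| <= N (x - y).
Proof.
move=> sN; have h1 := sN.2 (x - y) y; have h2 := sN.2 (y - x) x.
rewrite !subrK in h1 h2; rewrite -opprB seminormN // in h2.
by rewrite ler_norml; apply/andP; split; lra.
Qed.

Lemma seminorm_sum (R : realType) (m : nat) (N : 'cV[R]_m -> R)
    (I : Type) (s : seq I) (f : I -> 'cV[R]_m) :
  is_seminorm N -> N (\sum_(i <- s) f i) <= \sum_(i <- s) N (f i).
Proof.
move=> sN; elim: s => [|i s IH]; first by rewrite !big_nil seminorm0.
by rewrite !big_cons (le_trans (sN.2 _ _))// lerD2l.
Qed.

Lemma l1norm_norm (R : realType) (m : nat) : is_norm (@l1norm R m).
Proof.
split.
- move=> x x0; have [i xi0] : exists i, x i ord0 != 0.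
    apply/existsP; apply: contra_neqT x0 => /existsPn x0.
    by apply/colP => i; have := x0 i; rewrite negbK mxE => /eqP.
  rewrite /l1norm (bigD1 i)//= ltr_pwDl ?normr_gt0// sumr_ge0// => j _.
- move=> a x; rewrite /l1norm mulr_sumr; apply: eq_bigr => i _.
  by rewrite mxE normrM.
- move=> x y; rewrite /l1norm -big_split/=; apply: ler_sum => i _.
  by rewrite mxE ler_normD.
Qed.

Lemma l1norm_gt0 (R : realType) (m : nat) (x : 'cV[R]_m) :
  x != 0 -> 0 < l1norm x.
Proof. by case: (l1norm_norm R m) => + _ _; apply. Qed.

Lemma seminorm_le_l1norm (R : realType) (m : nat) (N : 'cV[R]_m -> R) x :
  is_seminorm N -> N x <= (\sum_i N (delta_mx i ord0)) * l1norm x.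
Proof.
move=> sN; rewrite [in N x](matrix_sum_delta x).
apply: (le_trans (seminorm_sum _ _ sN)).
rewrite /l1norm mulr_sumr; apply: ler_sum => i _.
rewrite big_ord1 sN.1 mulrC ler_wpM2r//.
rewrite (bigD1 i)//= lerDl sumr_ge0// => j _; exact: seminorm_ge0.
Qed.

Lemma seminorm_l1norm_lipschitz (R : realType) (m : nat)
    (N : 'cV[R]_m -> R) (C : R) :
  is_seminorm N -> (forall x, N x <= C * l1norm x) ->
  forall x y, `|N x - N y| <= C * l1norm (x - y).
Proof. by move=> sN NC x y; apply: le_trans (NC _); exact: seminorm_distB. Qed.

Lemma cvg_near_dist (R : realType) (U : set_system nat) {FU : Filter U}
    (u : nat -> R) (l : R) :
  u n @[n --> U] --> l ->
  forall d, 0 < d -> \forall n \near U, `|u n - l| <= d.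
Proof.
move=> /cvgrPdist_le + d d0 => /(_ d d0).
by apply: filterS => n; rewrite distrC.
Qed.

Lemma l1norm_sphere_compact (R : realType) (m : nat) (U : set_system nat)
    (UU : UltraFilter U) (y : nat -> 'cV[R]_m) :
  (forall n, l1norm (y n) = 1) ->
  exists2 z, l1norm z = 1 &
    forall d, 0 < d -> \forall n \near U, l1norm (y n - z) <= d.
Proof.
move=> y1; have PU := @ultra_proper _ _ UU.
have yb i n : `|y n i ord0| <= 1.
  rewrite -(y1 n) /l1norm (bigD1 i)//= lerDl sumr_ge0//.
have /choice [l yl] i : exists l : R, y n i ord0 @[n --> U] --> l.
  exact: (ultra_bounded_cvg UU (yb i)).
pose z : 'cV[R]_m := \col_i l i.
have yz d : 0 < d -> \forall n \near U, l1norm (y n - z) <= d.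
  (* With [m.+1] as divisor the quotient makes sense in dimension 0 too, and the [m] coordinate
     errors still add up to at most [d]. *)
  move=> d0; have d'0 : 0 < d / m.+1%:R by rewrite divr_gt0.
  have : \forall n \near U, forall i, `|y n i ord0 - l i| <= d / m.+1%:R.
    by apply: filter_forall => i; exact: cvg_near_dist.
  apply: filterS => n yn; rewrite /l1norm.
  apply: (@le_trans _ _ (\sum_(i < m) d / m.+1%:R)).
    by apply: ler_sum => i _; rewrite !mxE.
  rewrite sumr_const card_ord -[leLHS]mulr_natr mulrAC ler_pdivrMr//.
  by rewrite ler_wpM2l ?ler_nat// ltW.
exists z => //; apply/eqP; rewrite eq_le.
have sS := norm_seminorm (l1norm_norm R m).
apply/andP; split; apply/ler_addgt0Pr => d d0.
- have [n yn] := filter_ex (yz _ d0).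
  have := seminorm_distB z (y n) sS; rewrite -[z - y n]opprB seminormN// y1.
  by move=> /(le_trans (ler_norm _)); lra.
- have [n yn] := filter_ex (yz _ d0).
  have := seminorm_distB (y n) z sS; rewrite y1.
  by move=> /(le_trans (ler_norm _)); lra.
Qed.

(** Otherwise unit vectors with [N (y n) <= n.+1%:R^-1] would accumulate at some [z] of the sphere,
    and the Lipschitz bound on [N] would contradict [0 < N z]. *)
Lemma norm_ge_l1norm (R : realType) (m : nat) (N : 'cV[R]_m -> R) :
  is_norm N -> exists2 c, 0 < c & forall x, c * l1norm x <= N x.
Proof.
move=> nN; have sN := norm_seminorm nN.
have sS := norm_seminorm (l1norm_norm R m).
apply: contrapT => noc.
have /choice [y yP] (n : nat) : exists y : 'cV[R]_m,
    l1norm y = 1 /\ N y <= n.+1%:R^-1.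
  apply: contrapT => noy; apply: noc; exists n.+1%:R^-1; first by rewrite invr_gt0.
  move=> x; have [->|x0] := eqVneq x 0; first by rewrite !seminorm0// mulr0.
  have Sx := l1norm_gt0 x0.
  rewrite leNgt; apply/negP => Nx; apply: noy; exists ((l1norm x)^-1 *: x).
  rewrite (proj1 sS) (proj1 sN) gtr0_norm ?invr_gt0// mulVf ?gt_eqF//; split=> //.
  by rewrite ler_pdivrMl// mulrC ltW.
have [U [UU ooU]] := exists_ultra_eventually.
have PU := @ultra_proper _ _ UU.
have [z z1 yz] := l1norm_sphere_compact UU (fun n => proj1 (yP n)).
have z0 : z != 0.
  by apply/eqP => z0; move: z1; rewrite z0 seminorm0// => /eqP; rewrite eq_sym oner_eq0.
have Nz : 0 < N z by case: nN => + _ _; apply.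
pose C := \sum_i N (delta_mx i ord0 : 'cV[R]_m).
have NC x : N x <= C * l1norm x by exact: seminorm_le_l1norm.
have C0 : 0 <= C by apply: sumr_ge0 => i _; exact: seminorm_ge0.
(* Within this radius [N] varies by at most [N z / 4]; with [N (y n) <= N z / 2] this bounds [N z]
   by three quarters of itself. The summand 1 guards against [C = 0]. *)
have h1 := yz (N z / (4 * (C + 1))) ltac:(by rewrite divr_gt0// mulr_gt0// ltr_wpDl).
have h2 : \forall n \near U, n.+1%:R^-1 <= N z / 2 :> R.
  apply: ooU; have := cvg_near_dist (@cvg_harmonic R) (d := N z / 2).
  move=> /(_ _ ltac:(by rewrite divr_gt0)); apply: filterS => n.
  by rewrite subr0 /harmonic/= gtr0_norm// invr_gt0.
have [n [yn n2]] := filter_ex (filterI h1 h2).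
have := seminorm_l1norm_lipschitz sN NC z (y n).
rewrite -[z - y n]opprB seminormN// => /(le_trans (ler_norm _)) h3.
have h4 : C * l1norm (y n - z) <= N z / 4.
  apply: (@le_trans _ _ (C * (N z / (4 * (C + 1))))); first by rewrite ler_wpM2l.
  have C1 : C / (C + 1) <= 1 by rewrite ler_pdivrMr ?ltr_wpDl// mul1r lerDl.
  rewrite [leLHS](_ : _ = N z / 4 * (C / (C + 1))); last first.
    by field; rewrite gt_eqF// ltr_wpDl.
  by rewrite ler_piMr// divr_ge0// ltW.
have h5 : N (y n) <= N z / 2 := le_trans (yP n).2 n2.
by lra.
Qed.

(** * Limits of sequences of seminorms *)

Lemma seminorm_ultra_limit (R : realType) (m : nat) (U : set_system nat)
    (UU : UltraFilter U) (P : nat -> 'cV[R]_m -> R) (C : R) :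
  (forall n, is_seminorm (P n)) -> (forall n x, P n x <= C * l1norm x) ->
  exists Q : 'cV[R]_m -> R,
    [/\ is_seminorm Q, forall x, Q x <= C * l1norm x
      & forall x, P n x @[n --> U] --> Q x].
Proof.
move=> sP PC; have PU := @ultra_proper _ _ UU.
have /choice [Q PQ] x : exists l : R, P n x @[n --> U] --> l.
  apply: (ultra_bounded_cvg UU (C := C * l1norm x)) => n.
  by rewrite ger0_norm// seminorm_ge0.
exists Q; split=> //; first split.
- move=> a x; apply: (@cvg_unique _ _ _ _ _ _ (PQ (a *: x))) => //.
  rewrite (_ : (fun n => _) = (fun n => `|a| * P n x)); last first.
    by apply/funext => n; rewrite (sP n).1.
  by apply: cvgM => //; exact: cvg_cst.
- move=> x y; apply: (ler_cvg_to (PQ _) (cvgD (PQ x) (PQ y))).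
  by apply: filterE => n; exact: (sP n).2.
- by move=> x; apply: (cvgr_to_le (PQ x)); exact: filterE.
Qed.

(* Pointwise convergence of equi-Lipschitz functions is uniform on the
   compact unit sphere. *)
Lemma seminorm_cvg_uniform (R : realType) (m : nat) (U : set_system nat)
    (UU : UltraFilter U) (P : nat -> 'cV[R]_m -> R) (Q : 'cV[R]_m -> R)
    (C : R) :
  (forall n, is_seminorm (P n)) -> (forall n x, P n x <= C * l1norm x) ->
  is_seminorm Q -> (forall x, Q x <= C * l1norm x) ->
  (forall x, P n x @[n --> U] --> Q x) ->
  forall d, 0 < d ->
    \forall n \near U, forall x, `|P n x - Q x| <= d * l1norm x.
Proof.
move=> sP PC sQ QC PQ d d0; have PU := @ultra_proper _ _ UU.
have sS := norm_seminorm (l1norm_norm R m).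
pose E n := forall x, `|P n x - Q x| <= d * l1norm x.
have [//|UnE] := in_ultra_setVsetC (E : set nat) UU; exfalso.
have bad n : ~ E n -> exists2 y, l1norm y = 1 & d < `|P n y - Q y|.
  move=> /existsNP[x /negP]; rewrite -ltNge => xb.
  have x0 : x != 0.
    by apply: contraTneq xb => ->; rewrite !seminorm0// subrr normr0 mulr0 ltxx.
  have Sx := l1norm_gt0 x0.
  exists ((l1norm x)^-1 *: x).
    by rewrite sS.1 gtr0_norm ?invr_gt0// mulVf ?gt_eqF.
  rewrite (sP n).1 sQ.1 -mulrBr normrM normr_id [`|_^-1|]gtr0_norm ?invr_gt0//.
  by rewrite ltr_pdivlMl// mulrC.
have [n0 /bad[y0 y01 _]] := filter_ex UnE.
(* Indices satisfying [E] get the filler [y0], so that the whole sequence lies on the sphere. *)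
have /choice [y yP] n : exists y, l1norm y = 1 /\ (~ E n -> d < `|P n y - Q y|).
  have [En|/bad[y y1 yd]] := pselect (E n); last by exists y.
  by exists y0; split.
have [z z1 yz] := l1norm_sphere_compact UU (fun n => (yP n).1).
have C0 : 0 <= C.
  by have := QC z; rewrite z1 mulr1; apply: le_trans; exact: seminorm_ge0.
have e0 : 0 < d / (4 * (C + 1)) by rewrite divr_gt0// mulr_gt0// ltr_wpDl.
have d2 : 0 < d / 2 by rewrite divr_gt0.
have [n [nE [yn Pn]]] := filter_ex
  (filterI UnE (filterI (yz _ e0) (cvg_near_dist (PQ z) d2))).
have h1 := seminorm_l1norm_lipschitz (sP n) (PC n) (y n) z.
have h2 := seminorm_l1norm_lipschitz sQ QC (y n) z.
have h3 := (yP n).2 nE.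
have h4 : C * l1norm (y n - z) < d / 4.
  apply: (@le_lt_trans _ _ (C * (d / (4 * (C + 1))))); first by rewrite ler_wpM2l.
  have C1 : C / (C + 1) < 1 by rewrite ltr_pdivrMr ?ltr_wpDl// mul1r ltrDl.
  rewrite [ltLHS](_ : _ = d / 4 * (C / (C + 1))); last first.
    by field; rewrite gt_eqF// ltr_wpDl.
  by rewrite gtr_pMr// divr_gt0.
(* The two Lipschitz terms are below [d / 4] and the middle one is at most [d / 2], so the sum stays
   below [d]. *)
have h5 : `|P n (y n) - Q (y n)| <=
    `|P n (y n) - P n z| + `|P n z - Q z| + `|Q (y n) - Q z|.
  rewrite [`|Q (y n) - _|]distrC.
  rewrite [X in `|X| <= _](_ : _ =
    (P n (y n) - P n z) + (P n z - Q z) + (Q z - Q (y n))); last by ring.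
  by rewrite (le_trans (ler_normD _ _))// lerD2r ler_normD.
by lra.
Qed.

(** * Irreducibility and bounded eccentricity *)

(** A subspace of maximal dimension inside [Q] absorbs every vector of [Q], since adding the line of
    such a vector stays inside [Q]. This turns the kernel of a seminorm into a [vspace]. *)
Lemma vspace_of_pred (K : fieldType) (vT : vectType K) (Q : vT -> Prop) :
  Q 0 -> (forall a x, Q x -> Q (a *: x)) ->
  (forall x y, Q x -> Q y -> Q (x + y)) ->
  exists V : {vspace vT}, forall x, x \in V <-> Q x.
Proof.
move=> Q0 QZ QD.
pose D n := `[< exists V : {vspace vT}, \dim V = n /\ forall x, x \in V -> Q x >].
have D0 : exists n, D n.
  by exists 0%N; apply/asboolP; exists 0%VS; rewrite dimv0; split=> // x /[!memv0]/eqP->.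
have Dle n : D n -> (n <= \dim {:vT})%N.
  by move=> /asboolP[V [<- _]]; rewrite dimvS// subvf.
case: (ex_maxnP D0 Dle) => n /asboolP[V [dV VQ]] nmax.
exists V => x; split; first exact: VQ.
move=> Qx; set W := (V + <[x]>)%VS.
have /nmax : D (\dim W).
  apply/asboolP; exists W; split=> // _ /memv_addP[u uV [_ /vlineP[a ->] ->]].
  by apply: QD; [exact: VQ|exact: QZ].
have VW : (V <= W)%VS by exact: addvSl.
rewrite -dV => dWV; have /eqP -> : V == W by rewrite eqEdim VW.
by rewrite (subvP (addvSr V <[x]>)) ?memv_line.
Qed.

(* Otherwise normalised norms would accumulate at a nonzero seminorm whose
   nontrivial kernel is invariant under all the matrices. *)
Lemma irreducible_eccentricity (R : realType) (m r : nat)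
    (A : 'I_r -> 'M[R]_m) (K : R) :
  irreducible_family A ->
  exists2 C, 0 < C & forall N : 'cV[R]_m -> R, is_norm N ->
    (forall i x, N (A i *m x) <= K * N x) ->
    forall x y, N x * l1norm y <= C * (N y * l1norm x).
Proof.
move=> irrA; apply: contrapT => noC.
have sS := norm_seminorm (l1norm_norm R m).
(* A counterexample to the constant [k.+1] is rescaled: the norm to have sum 1 over the basis
   vectors, the vector to lie on the unit sphere. *)
have /choice [Py PyP] (k : nat) : exists Py : ('cV[R]_m -> R) * 'cV[R]_m,
    [/\ is_seminorm Py.1, forall i x, Py.1 (A i *m x) <= K * Py.1 x,
      \sum_i Py.1 (delta_mx i ord0) = 1, l1norm Py.2 = 1
      & Py.1 Py.2 <= k.+1%:R^-1].
  apply: contrapT => noPy; apply: noC; exists k.+1%:R => //.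
  move=> N nN NA x y; rewrite leNgt; apply/negP => Nxy; apply: noPy.
  have sN := norm_seminorm nN.
  have x0 : x != 0.
    by apply: contraTneq Nxy => ->; rewrite (seminorm0 sS) (seminorm0 sN) mul0r !mulr0 ltxx.
  have y0 : y != 0.
    by apply: contraTneq Nxy => ->; rewrite (seminorm0 sS) (seminorm0 sN) mul0r !mulr0 ltxx.
  have Sx := l1norm_gt0 x0; have Sy := l1norm_gt0 y0.
  have NM := seminorm_le_l1norm x sN.
  set M := \sum_i _ in NM.
  have Nx : 0 < N x by case: nN => + _ _; apply.
  have M0 : 0 < M by rewrite -(pmulr_lgt0 _ Sx) (lt_le_trans Nx).
  exists (fun z => M^-1 * N z, (l1norm y)^-1 *: y); split=> /=.
  - split=> [a z|z1 z2]; first by rewrite sN.1 mulrCA.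
    by rewrite -mulrDr ler_pM2l ?invr_gt0// sN.2.
  - by move=> i z; rewrite mulrCA ler_pM2l ?invr_gt0.
  - by rewrite -mulr_sumr mulVf// gt_eqF.
  - by rewrite sS.1 gtr0_norm ?invr_gt0// mulVf ?gt_eqF.
  - rewrite sN.1 gtr0_norm ?invr_gt0//.
    rewrite ler_pdivrMl// ler_pdivrMl// mulrA ler_pdivlMr//.
    have h : N x * l1norm y <= M * l1norm x * l1norm y by rewrite ler_pM2r.
    by rewrite -(ler_pM2r Sx); lra.
pose P k := (Py k).1; pose y k := (Py k).2.
have sP k : is_seminorm (P k) by case: (PyP k).
have P1 k x : P k x <= 1 * l1norm x.
  by have := seminorm_le_l1norm x (sP k); case: (PyP k) => _ _ ->.
have [U [UU ooU]] := exists_ultra_eventually.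
have PU := @ultra_proper _ _ UU.
have [Q [sQ Q1 PQ]] := seminorm_ultra_limit UU sP P1.
have PQu := seminorm_cvg_uniform UU sP P1 sQ Q1 PQ.
have QA i x : Q (A i *m x) <= K * Q x.
  have KP : K * P n x @[n --> U] --> K * Q x.
    by apply: cvgM; [exact: cvg_cst|exact: PQ].
  by apply: (ler_cvg_to (PQ _) KP); apply: filterE => n; case: (PyP n) => _ + _ _ _; apply.
have Qsum : \sum_i Q (delta_mx i ord0) = 1.
  have Ps : \sum_i P n (delta_mx i ord0) @[n --> U]
      --> \sum_i Q (delta_mx i ord0).
    by apply: cvg_big => //; exact: add_continuous.
  apply: (@cvg_unique _ _ _ _ _ _ Ps) => //.
  rewrite (_ : (fun n => _) = cst 1); first exact: cvg_cst.
  by apply/funext => n; case: (PyP n).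
have [V VQ] : exists V : {vspace 'cV[R]_m}, forall x, x \in V <-> Q x = 0.
  apply: vspace_of_pred; first exact: seminorm0.
  - by move=> a x Qx; rewrite sQ.1 Qx mulr0.
  - move=> x1 x2 Q1x Q2x; apply/eqP; rewrite eq_le seminorm_ge0// andbT.
    by rewrite (le_trans (sQ.2 _ _))// Q1x Q2x addr0.
have VA i x : x \in V -> A i *m x \in V.
  move=> /VQ Qx; apply/VQ/eqP; rewrite eq_le seminorm_ge0// andbT.
  by rewrite (le_trans (QA _ _))// Qx mulr0.
(* A zero kernel makes [Q] a norm, bounded below on the sphere, against the smallness of
   [P n (y n)]; a full kernel contradicts [Qsum]. *)
have [V0|VT] := irrA V VA.
- have nQ : is_norm Q.
    split; [|exact: sQ.1|exact: sQ.2] => x x0.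
    rewrite lt_neqAle seminorm_ge0// andbT; apply: contra x0 => /eqP Qx.
    by rewrite -memv0 -V0; apply/VQ.
  have [c c0 Qc] := norm_ge_l1norm nQ.
  have c2 : 0 < c / 4 by rewrite divr_gt0.
  have h2 : \forall n \near U, n.+1%:R^-1 <= c / 4 :> R.
    apply: ooU; have := cvg_near_dist (@cvg_harmonic R) (d := c / 4).
    move=> /(_ _ c2); apply: filterS => n.
    by rewrite subr0 /harmonic/= gtr0_norm// invr_gt0.
  have [n [Pn n2]] := filter_ex (filterI (PQu _ c2) h2).
  have [_ _ _ Sy Pyn] := PyP n.
  have := Pn (y n); have := Qc (y n); rewrite /y Sy !mulr1 => Qy.
  rewrite ler_norml => /andP[Pn' _].
  have : P n (Py n).2 <= c / 4 := le_trans Pyn n2.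
  by lra.
- have : \sum_i Q (delta_mx i ord0) = 0.
    by apply: big1 => i _; apply/VQ; rewrite VT memvf.
  by rewrite Qsum => /eqP; rewrite oner_eq0.
Qed.

(** * The operator [max_image] and the extremal ratios *)

Lemma norm_neq0 (R : realType) (m : nat) (N : 'cV[R]_m -> R) (x : 'cV[R]_m) :
  is_norm N -> x != 0 -> 0 < N x.
Proof. by case=> + _ _; apply. Qed.

Lemma seminorm_le_norm (R : realType) (m : nat) (M N : 'cV[R]_m -> R) :
  is_seminorm M -> is_norm N -> exists2 K, 0 < K & forall x, M x <= K * N x.
Proof.
move=> sM nN; have [c c0 Nc] := norm_ge_l1norm nN.
have MC x := seminorm_le_l1norm x sM; set C := \sum_i _ in MC.
have C0 : 0 <= C by apply: sumr_ge0 => i _; exact: seminorm_ge0.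
exists ((C + 1) / c); first by rewrite divr_gt0// ltr_wpDl.
move=> x; apply: (le_trans (MC x)); have := Nc x.
rewrite -ler_pdivlMl// mulrC => Sx.
have S0 : 0 <= l1norm x by exact: seminorm_ge0 (norm_seminorm (l1norm_norm R m)).
rewrite -mulrA [c^-1 * _]mulrC (le_trans (ler_wpM2l C0 Sx))// ler_wpM2r// ?lerDl//.
exact: le_trans Sx.
Qed.

Lemma max_image_ge (R : realType) (m r : nat) (A : 'I_r -> 'M[R]_m)
    (N : 'cV[R]_m -> R) i x : N (A i *m x) <= max_image A N x.
Proof. exact: (le_bigmax 0 (fun i => N (A i *m x))). Qed.

Lemma max_image_ge0 (R : realType) (m r : nat) (A : 'I_r -> 'M[R]_m)
    (N : 'cV[R]_m -> R) (x : 'cV[R]_m) : 0 <= max_image A N x.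
Proof. exact: bigmax_ge_id. Qed.

Lemma max_image_le (R : realType) (m r : nat) (A : 'I_r -> 'M[R]_m)
    (N : 'cV[R]_m -> R) x b :
  0 <= b -> (forall i, N (A i *m x) <= b) -> max_image A N x <= b.
Proof. by move=> b0 Nb; apply: bigmax_le. Qed.

Lemma max_image_attained (R : realType) (m r : nat) (A : 'I_r -> 'M[R]_m)
    (N : 'cV[R]_m -> R) (x : 'cV[R]_m) :
  (0 < r)%N -> is_seminorm N -> exists i, max_image A N x = N (A i *m x).
Proof.
move=> r0 sN; have N0 i : xpredT i -> 0 <= N (A i *m x) by move=> _; exact: seminorm_ge0.
by have [i _ iE] := eq_bigmax (Ordinal r0) xpredT _ isT N0; exists i.
Qed.

Lemma max_image_seminorm (R : realType) (m r : nat) (A : 'I_r -> 'M[R]_m)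
    (N : 'cV[R]_m -> R) : is_seminorm N -> is_seminorm (max_image A N).
Proof.
move=> sN; split=> [a x|x y].
- have [->|a0] := eqVneq a 0.
    rewrite scale0r normr0 mul0r; apply/eqP; rewrite eq_le max_image_ge0 andbT.
    by apply: max_image_le => // i; rewrite mulmx0 seminorm0.
  apply/eqP; rewrite eq_le; apply/andP; split.
    apply: max_image_le => [|i]; first by rewrite mulr_ge0// max_image_ge0.
    by rewrite -scalemxAr sN.1 ler_wpM2l// max_image_ge.
  rewrite mulrC -ler_pdivlMr ?normr_gt0//; apply: max_image_le => [|i].
    by rewrite divr_ge0// max_image_ge0.
  by rewrite ler_pdivlMr ?normr_gt0// mulrC -sN.1 scalemxAr max_image_ge.
- apply: max_image_le => [|i]; first by rewrite addr_ge0// max_image_ge0.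
  by rewrite mulmxDr (le_trans (sN.2 _ _))// lerD// max_image_ge.
Qed.

(** If the value at some nonzero [x] were 0, every [A i] would kill [x], so the line of [x] would be
    invariant, hence the whole space: this is the excluded case. *)
Lemma max_image_norm (R : realType) (m r : nat) (A : 'I_r -> 'M[R]_m)
    (N : 'cV[R]_m -> R) :
  irreducible_family A -> ~ (m = 1%N /\ forall i, A i = 0) ->
  is_norm N -> is_norm (max_image A N).
Proof.
move=> irrA nondegA nN; have sN := norm_seminorm nN.
have sF := max_image_seminorm A sN.
split; [move=> x x0|exact: sF.1|exact: sF.2].
rewrite lt_neqAle seminorm_ge0// andbT eq_sym; apply/negP => /eqP Fx.
have Ax i : A i *m x = 0.
  apply/eqP; apply: contraT => /(norm_neq0 nN).
  by rewrite ltNge -Fx max_image_ge.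
have lineA i y : y \in <[x]>%VS -> A i *m y \in <[x]>%VS.
  by move=> /vlineP[a ->]; rewrite -scalemxAr Ax scaler0 mem0v.
have [V0|VT] := irrA _ lineA.
  by move: x0; rewrite -memv0 -V0 memv_line.
apply: nondegA; split.
  by have := dimvf 'cV[R]_m; rewrite -VT dim_vline x0 /dim/= muln1 => <-.
move=> i; apply/matrixP => j k.
have Ad (y : 'cV[R]_m) : A i *m y = 0.
  have /vlineP[a ->] : y \in <[x]>%VS by rewrite VT memvf.
  by rewrite -scalemxAr Ax scaler0.
by have := Ad (delta_mx k ord0); rewrite -colE => /colP/(_ j); rewrite !mxE.
Qed.

Lemma rho_set_has_sup (R : realType) (m r : nat) (A : 'I_r -> 'M[R]_m)
    (N : 'cV[R]_m -> R) (e : 'cV[R]_m) : e != 0 -> is_norm N ->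
  has_sup [set max_image A N x / N x | x in [set x | x != 0]].
Proof.
move=> e0 nN; split; first by exists (max_image A N e / N e), e.
have [K K0 FK] := seminorm_le_norm (max_image_seminorm A (norm_seminorm nN)) nN.
by exists K => _ [x /= x0 <-]; rewrite ler_pdivrMr// norm_neq0.
Qed.

Lemma rho_set_has_inf (R : realType) (m r : nat) (A : 'I_r -> 'M[R]_m)
    (N : 'cV[R]_m -> R) (e : 'cV[R]_m) : e != 0 -> is_norm N ->
  has_inf [set max_image A N x / N x | x in [set x | x != 0]].
Proof.
move=> e0 nN; split; first by exists (max_image A N e / N e), e.
exists 0 => _ [x /= x0 <-]; rewrite divr_ge0 ?max_image_ge0//.
by rewrite ltW// norm_neq0.
Qed.

Lemma max_image_le_rho_plus (R : realType) (m r : nat) (A : 'I_r -> 'M[R]_m)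
    (N : 'cV[R]_m -> R) (x : 'cV[R]_m) :
  is_norm N -> max_image A N x <= rho_plus A N * N x.
Proof.
move=> nN; have sN := norm_seminorm nN.
have [->|x0] := eqVneq x 0.
  by rewrite (seminorm0 (max_image_seminorm A sN)) seminorm0// mulr0.
rewrite -ler_pdivrMr ?norm_neq0//; apply: ub_le_sup; last by exists x.
by have [] := rho_set_has_sup A x0 nN.
Qed.

Lemma max_image_ge_rho_minus (R : realType) (m r : nat) (A : 'I_r -> 'M[R]_m)
    (N : 'cV[R]_m -> R) (x : 'cV[R]_m) :
  is_norm N -> rho_minus A N * N x <= max_image A N x.
Proof.
move=> nN; have sN := norm_seminorm nN.
have [->|x0] := eqVneq x 0.
  by rewrite (seminorm0 (max_image_seminorm A sN)) seminorm0// mulr0.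
rewrite -ler_pdivlMr ?norm_neq0//; apply: ge_inf; last by exists x.
by have [] := rho_set_has_inf A x0 nN.
Qed.

Lemma rho_plus_le (R : realType) (m r : nat) (A : 'I_r -> 'M[R]_m)
    (N : 'cV[R]_m -> R) (e : 'cV[R]_m) K : e != 0 -> is_norm N ->
  (forall x, max_image A N x <= K * N x) -> rho_plus A N <= K.
Proof.
move=> e0 nN FK; apply: ge_sup; first by have [] := rho_set_has_sup A e0 nN.
by move=> _ [x /= x0 <-]; rewrite ler_pdivrMr// norm_neq0.
Qed.

Lemma rho_minus_ge (R : realType) (m r : nat) (A : 'I_r -> 'M[R]_m)
    (N : 'cV[R]_m -> R) (e : 'cV[R]_m) K : e != 0 -> is_norm N ->
  (forall x, K * N x <= max_image A N x) -> K <= rho_minus A N.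
Proof.
move=> e0 nN FK; apply: lb_le_inf; first by have [] := rho_set_has_inf A e0 nN.
by move=> _ [x /= x0 <-]; rewrite ler_pdivlMr// norm_neq0.
Qed.

Lemma rho_plus_adherent (R : realType) (m r : nat) (A : 'I_r -> 'M[R]_m)
    (N : 'cV[R]_m -> R) (e : 'cV[R]_m) d : e != 0 -> is_norm N -> 0 < d ->
  exists2 x, x != 0 & (rho_plus A N - d) * N x <= max_image A N x.
Proof.
move=> e0 nN d0.
have [_ [x /= x0 <-] /ltW] := sup_adherent d0 (rho_set_has_sup A e0 nN).
by rewrite ler_pdivlMr ?norm_neq0//; exists x.
Qed.

Lemma rho_minus_adherent (R : realType) (m r : nat) (A : 'I_r -> 'M[R]_m)
    (N : 'cV[R]_m -> R) (e : 'cV[R]_m) d : e != 0 -> is_norm N -> 0 < d ->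
  exists2 x, x != 0 & max_image A N x <= (rho_minus A N + d) * N x.
Proof.
move=> e0 nN d0.
have [_ [x /= x0 <-] /ltW] := inf_adherent d0 (rho_set_has_inf A e0 nN).
by rewrite ler_pdivrMr ?norm_neq0//; exists x.
Qed.

(** * Matrix products and the joint spectral radius *)

Lemma word_prod_rcons (R : realType) (m r : nat) (A : 'I_r -> 'M[R]_m) w i :
  word_prod A (rcons w i) = A i *m word_prod A w.
Proof. by rewrite /word_prod -cats1 foldl_cat. Qed.

Lemma word_prod_le (R : realType) (m r : nat) (A : 'I_r -> 'M[R]_m)
    (N : 'cV[R]_m -> R) (rho : R) : 0 <= rho ->
  (forall i x, N (A i *m x) <= rho * N x) ->
  forall w x, N (word_prod A w *m x) <= rho ^+ size w * N x.
Proof.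
move=> rho0 NA; elim/last_ind => [|w i IH] x.
  by rewrite /word_prod/= mul1mx mul1r.
rewrite word_prod_rcons -mulmxA size_rcons exprS -mulrA.
by rewrite (le_trans (NA _ _))// ler_wpM2l.
Qed.

(** The word is built greedily: each new letter attains the maximum at the current image of [x]. *)
Lemma word_prod_attained (R : realType) (m r : nat) (A : 'I_r -> 'M[R]_m)
    (N : 'cV[R]_m -> R) (rho : R) : (0 < r)%N -> is_seminorm N ->
  (forall x, max_image A N x = rho * N x) ->
  forall n x, exists w : n.-tuple 'I_r, N (word_prod A w *m x) = rho ^+ n * N x.
Proof.
move=> r0 sN NA; elim=> [|n IH] x.
  by exists [tuple]; rewrite /word_prod/= mul1mx mul1r.
have [w wx] := IH x.
have [i ix] := max_image_attained A (word_prod A w *m x) r0 sN.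
exists [tuple of rcons w i].
by rewrite word_prod_rcons -mulmxA -ix NA wx exprS mulrA.
Qed.

Lemma cvg_powR_invn (R : realType) (c : R) :
  0 < c -> c `^ (n%:R^-1) @[n --> \oo] --> (1 : R).
Proof.
(* The shift turns the exponent into [harmonic n] and discards the index 0, where the inverse is a
   default value. *)
move=> c0; rewrite -(cvg_shiftS (fun n => c `^ (n%:R^-1))).
rewrite (_ : (fun n => _) = (fun n => expR (ln c * harmonic n))); last first.
  by apply/funext => n; rewrite expRM lnK.
have : ln c * harmonic n @[n --> \oo] --> ln c * (0 : R).
  by apply: cvgM; [exact: cvg_cst|exact: cvg_harmonic].
by rewrite mulr0 => /(continuous_cvg _ (@continuous_expR R 0)); rewrite expR0.
Qed.

(** Passing between [nu] and [N] costs a factor [K * L], so the largest norm of a product of [n]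
    matrices equals [rho ^+ n] up to that factor on either side; its [n]-th root tends to 1. *)
Lemma jsr_barabanov (R : realType) (m r : nat) (A : 'I_r -> 'M[R]_m)
    (nu N : 'cV[R]_m -> R) (rho : R) (e : 'cV[R]_m) :
  (0 < r)%N -> e != 0 -> 0 < rho -> is_norm nu -> is_barabanov A rho N ->
  jsr nu A = rho.
Proof.
move=> r0 e0 rho0 nnu [nN NA]; have sN := norm_seminorm nN.
have snu := norm_seminorm nnu.
have [K K0 nuN] := seminorm_le_norm snu nN.
have [L L0 Nnu] := seminorm_le_norm sN nnu.
have NAi i x : N (A i *m x) <= rho * N x by rewrite -NA max_image_ge.
have opub (w : seq 'I_r) :
    ubound [set nu (word_prod A w *m x) / nu x | x in [set x | x != 0]]
      (K * L * rho ^+ size w).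
  move=> _ [x /= x0 <-]; rewrite ler_pdivrMr ?norm_neq0//.
  apply: (le_trans (nuN _)); rewrite -!mulrA ler_pM2l//.
  apply: (le_trans (word_prod_le (ltW rho0) NAi w x)).
  by rewrite mulrCA ler_pM2l ?exprn_gt0.
pose v n : R := \big[Num.max/0]_(w : n.-tuple 'I_r) opnorm nu (word_prod A w).
have v_le n : v n <= K * L * rho ^+ n.
  apply: bigmax_le => [|w _]; first by rewrite !mulr_ge0// ?exprn_ge0// ltW.
  rewrite -[X in rho ^+ X](size_tuple w); apply: ge_sup (opub w).
  by exists (nu (word_prod A w *m e) / nu e), e.
have v_ge n : (K * L)^-1 * rho ^+ n <= v n.
  have [w we] := word_prod_attained r0 sN NA n e.
  apply: le_trans (le_bigmax 0 _ w).
  apply: (@le_trans _ _ (nu (word_prod A w *m e) / nu e)); last first.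
    by apply: ub_le_sup; [exists (K * L * rho ^+ size w); exact: opub|exists e].
  rewrite ler_pdivlMr ?norm_neq0// -mulrA ler_pdivrMl ?mulr_gt0//.
  have h1 := Nnu (word_prod A w *m e); rewrite we in h1.
  have h2 := ler_wpM2l (exprn_ge0 n (ltW rho0)) (nuN e).
  apply: (le_trans h2); rewrite -mulrA mulrCA ler_pM2l//.
have root_le (c : R) n : 0 < c ->
    (c * rho ^+ n.+1) `^ (n.+1%:R^-1) = c `^ (n.+1%:R^-1) * rho.
  move=> c0; rewrite powRM ?exprn_ge0 ?ltW//; congr (_ * _).
  by rewrite -powR_mulrn ?ltW// -powRrM mulfV// powRr1// ltW.
have root_cvg (c : R) : 0 < c -> c `^ (n.+1%:R^-1) * rho @[n --> \oo] --> rho.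
  move=> /cvg_powR_invn; rewrite -(cvg_shiftS (fun n => c `^ (n%:R^-1))) => cc.
  rewrite (_ : nbhs rho = nbhs (1 * rho)); last by rewrite mul1r.
  by apply: cvgM; [exact: cc|exact: cvg_cst].
have KL0 : 0 < K * L by rewrite mulr_gt0.
have vcvg : v n `^ (n%:R^-1) @[n --> \oo] --> rho.
  rewrite -(cvg_shiftS (fun n => v n `^ (n%:R^-1))).
  apply: (@squeeze_cvgr _ _ _ _ (fun n => (K * L)^-1 `^ (n.+1%:R^-1) * rho)
    (fun n => (K * L) `^ (n.+1%:R^-1) * rho)).
  - apply: nearW => n; rewrite -!root_le ?invr_gt0//.
    have v0 : 0 <= v n.+1 by exact: bigmax_ge_id.
    have p0 (c : R) : 0 < c -> 0 <= c * rho ^+ n.+1.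
      by move=> c0; rewrite mulr_ge0 ?exprn_ge0// ltW.
    apply/andP; split; apply: ge0_ler_powR; rewrite ?nnegrE ?invr_ge0//.
    + by apply: p0; rewrite invr_gt0.
    + exact: p0.
  - by apply: root_cvg; rewrite invr_gt0.
  - exact: root_cvg KL0.
rewrite /jsr cvg_limn_supE; first exact: cvg_lim.
by apply/cvg_ex; exists rho.
Qed.

(** * A single relaxation step *)

Lemma relax_step_norm (R : realType) (m r : nat) (A : 'I_r -> 'M[R]_m)
    (N : 'cV[R]_m -> R) (l c : R) :
  is_norm N -> 0 < l -> 0 <= c ->
  is_norm (fun x => l * N x + c * max_image A N x).
Proof.
move=> nN l0 c0; have sN := norm_seminorm nN.
have sF := max_image_seminorm A sN; split.
- by move=> x x0; rewrite ltr_pwDl ?mulr_gt0 ?mulr_ge0 ?max_image_ge0// norm_neq0.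
- by move=> a x; rewrite sN.1 sF.1; ring.
- move=> x y; apply: (@le_trans _ _
    (l * (N x + N y) + c * (max_image A N x + max_image A N y))).
    by rewrite lerD// ler_wpM2l ?sN.2 ?sF.2// ltW.
  by rewrite le_eqVlt; apply/orP; left; apply/eqP; ring.
Qed.

Lemma max_image_relax_le (R : realType) (m r : nat) (A : 'I_r -> 'M[R]_m)
    (N N' : 'cV[R]_m -> R) (l c K : R) :
  0 <= l -> 0 <= c -> 0 <= K ->
  (forall x, N' x = l * N x + c * max_image A N x) ->
  (forall x, max_image A N x <= K * N x) ->
  forall x, max_image A N' x <= (l + c * K) * max_image A N x.
Proof.
move=> l0 c0 K0 N'E FK x; apply: max_image_le => [|i].
  by rewrite mulr_ge0 ?max_image_ge0// addr_ge0// mulr_ge0.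
rewrite N'E; apply: (@le_trans _ _ ((l + c * K) * N (A i *m x))).
  by rewrite mulrDl -mulrA lerD2l ler_wpM2l.
by rewrite ler_wpM2l ?max_image_ge// addr_ge0// mulr_ge0.
Qed.

(** The index attaining the maximum for [N] at [x] is tested in the maximum for [N']. *)
Lemma max_image_relax_ge (R : realType) (m r : nat) (A : 'I_r -> 'M[R]_m)
    (N N' : 'cV[R]_m -> R) (l c k : R) :
  (0 < r)%N -> is_seminorm N -> 0 <= c ->
  (forall x, N' x = l * N x + c * max_image A N x) ->
  (forall x, k * N x <= max_image A N x) ->
  forall x, (l + c * k) * max_image A N x <= max_image A N' x.
Proof.
move=> r0 sN c0 N'E Fk x.
have [i ->] := max_image_attained A x r0 sN.
apply: le_trans (max_image_ge A N' i x).
by rewrite N'E mulrDl -mulrA lerD2l ler_wpM2l.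
Qed.

(** With [F] for [max_image A N] and [K] for its largest ratio to [N], the bound [(l + c * K) * F x]
    on the new image is at most [K * N' x]: the terms in [c] agree, and those in [l] compare by
    [F x <= K * N x]. *)
Lemma rho_plus_relax (R : realType) (m r : nat) (A : 'I_r -> 'M[R]_m)
    (N N' : 'cV[R]_m -> R) (e : 'cV[R]_m) (l c : R) :
  e != 0 -> is_norm N -> is_norm N' -> 0 <= l -> 0 <= c ->
  (forall x, N' x = l * N x + c * max_image A N x) ->
  rho_plus A N' <= rho_plus A N.
Proof.
move=> e0 nN nN' l0 c0 N'E; apply: (rho_plus_le e0) => // x.
have FK y := max_image_le_rho_plus A y nN; set K := rho_plus A N in FK *.
have K0 : 0 <= K.
  by rewrite -(pmulr_lge0 _ (norm_neq0 nN e0)) (le_trans _ (FK e))// max_image_ge0.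
apply: (le_trans (max_image_relax_le l0 c0 K0 N'E FK x)).
rewrite N'E mulrDl mulrDr lerD//; first by rewrite mulrCA ler_wpM2l.
by rewrite -mulrA mulrCA.
Qed.

Lemma rho_minus_relax (R : realType) (m r : nat) (A : 'I_r -> 'M[R]_m)
    (N N' : 'cV[R]_m -> R) (e : 'cV[R]_m) (l c : R) :
  (0 < r)%N -> e != 0 -> is_norm N -> is_norm N' -> 0 <= l -> 0 <= c ->
  (forall x, N' x = l * N x + c * max_image A N x) ->
  rho_minus A N <= rho_minus A N'.
Proof.
move=> r0 e0 nN nN' l0 c0 N'E; apply: (rho_minus_ge e0) => // x.
have Fk y := max_image_ge_rho_minus A y nN; set k := rho_minus A N in Fk *.
apply: le_trans (max_image_relax_ge r0 (norm_seminorm nN) c0 N'E Fk x).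
rewrite N'E mulrDl mulrDr lerD//; first by rewrite mulrCA ler_wpM2l.
by rewrite -mulrA mulrCA.
Qed.

(** * Equality of the limits of the two ratios *)

Lemma exprn_unbounded (R : realType) (t B : R) : 1 < t ->
  exists k, B < t ^+ k.
Proof.
move=> t1; have t0 : 0 < t by lra.
have B0 : 0 < (`|B| + 1)^-1 by rewrite invr_gt0 ltr_wpDl.
have ti : `|t^-1| < 1 by rewrite gtr0_norm ?invr_gt0// invf_lt1.
have [k] : exists k, `|t^-1 ^+ k - 0| <= (`|B| + 1)^-1.
  by have [k] := filter_ex (cvg_near_dist (cvg_expr ti) B0); exists k.
rewrite subr0 exprVn gtr0_norm ?invr_gt0 ?exprn_gt0// lef_pV2 ?posrE ?exprn_gt0//.
by move=> Bk; exists k; have := ler_norm B; lra.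
Qed.

(* Here N and F stand for N_n x and F N_n x.  If x is within d of realising p for
   N_(n+1), then it is within L d for N_n, since otherwise the contribution of
   N_n to N_(n+1) would pull the ratio below p - d. *)
Lemma relax_back_plus (R : realType) (l lam c c2 d N F K p : R) :
  0 < l -> l <= lam -> 0 <= c -> c <= c2 -> 0 <= d -> 0 <= N -> 0 <= K ->
  F <= K * N -> (p - d) * (lam * N + c * F) <= (lam + c * (p + d)) * F ->
  (p - (1 + 2 * (c2 * K) / l) * d) * N <= F.
Proof.
move=> l0 llam c0 cc2 d0 N0 K0 FK h.
have lam0 : 0 < lam by exact: lt_le_trans llam.
rewrite -(ler_pM2l lam0).
(* Expanding [h] cancels [p * c * F] and leaves the error [2 * c * d * F], which [h1] and [h2] turn
   into a multiple of [lam * d * N]. *)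
have h1 : c * d * F <= c2 * d * (K * N).
  apply: (@le_trans _ _ (c * d * (K * N))); first by rewrite ler_wpM2l ?mulr_ge0.
  by rewrite ler_wpM2r ?mulr_ge0// ler_wpM2r.
have h2 : c2 * K * d * N <= lam * ((c2 * K) / l * d * N).
  rewrite !mulrA -[leLHS]mul1r.
  rewrite [leRHS](_ : _ = lam / l * (c2 * K * d * N)); last by ring.
  rewrite !mulrA ler_wpM2r// ler_wpM2r// ler_wpM2r// ler_wpM2r//.
    exact: le_trans cc2.
  by rewrite ler_pdivlMr// mul1r.
by lra.
Qed.

(** Counterpart of [relax_back_plus] for near minimisers, with the same error [2 * c * d * F]. *)
Lemma relax_back_minus (R : realType) (l lam c c2 d N F K q : R) :
  0 < l -> l <= lam -> 0 <= c -> c <= c2 -> 0 <= d -> 0 <= N -> 0 <= K ->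
  F <= K * N -> (lam + c * (q - d)) * F <= (q + d) * (lam * N + c * F) ->
  F <= (q + (1 + 2 * (c2 * K) / l) * d) * N.
Proof.
move=> l0 llam c0 cc2 d0 N0 K0 FK h.
have lam0 : 0 < lam by exact: lt_le_trans llam.
rewrite -(ler_pM2l lam0).
have h1 : c * d * F <= c2 * d * (K * N).
  apply: (@le_trans _ _ (c * d * (K * N))); first by rewrite ler_wpM2l ?mulr_ge0.
  by rewrite ler_wpM2r ?mulr_ge0// ler_wpM2r.
have h2 : c2 * K * d * N <= lam * ((c2 * K) / l * d * N).
  rewrite !mulrA -[leLHS]mul1r.
  rewrite [leRHS](_ : _ = lam / l * (c2 * K * d * N)); last by ring.
  rewrite !mulrA ler_wpM2r// ler_wpM2r// ler_wpM2r// ler_wpM2r//.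
    exact: le_trans cc2.
  by rewrite ler_pdivlMr// mul1r.
by lra.
Qed.

(** The constants are chosen in the order [d], [t], [k], [b], [n]: since [k] depends only on [t] and
    the eccentricity bound [C], the tolerance [b] can be made small enough to survive [k] steps back
    before [n] is fixed. *)
Lemma cvg_gap_closed (R : realType) (m r : nat) (A : 'I_r -> 'M[R]_m)
    (N : nat -> 'cV[R]_m -> R) (lam c : nat -> R) (e : 'cV[R]_m)
    (l c1 c2 p q : R) :
  irreducible_family A -> (0 < r)%N -> e != 0 ->
  (forall n, is_norm (N n)) ->
  (forall n x, N n.+1 x = lam n * N n x + c n * max_image A (N n) x) ->
  0 < l -> (forall n, l <= lam n <= 1) ->
  0 < c1 -> (forall n, c1 <= c n <= c2) ->
  (forall n, p <= rho_plus A (N n)) -> (forall n, rho_minus A (N n) <= q) ->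
  rho_plus A (N n) @[n --> \oo] --> p -> rho_minus A (N n) @[n --> \oo] --> q ->
  p <= q.
Proof.
move=> irrA r0 e0 nN NE l0 lamb c10 cb pub qlb pcvg qcvg.
rewrite leNgt; apply/negP => qp.
have sN n := norm_seminorm (nN n).
have lam_ge n : l <= lam n by case/andP: (lamb n).
have lam0 n : 0 < lam n by exact: lt_le_trans (lam_ge n).
have lam1 n : lam n <= 1 by case/andP: (lamb n).
have c1c n : c1 <= c n by case/andP: (cb n).
have c0 n : 0 < c n by exact: lt_le_trans (c1c n).
have cc2 n : c n <= c2 by case/andP: (cb n).
have c20 : 0 < c2 by exact: lt_le_trans (cc2 0%N).
pose F n x := max_image A (N n) x.
have N0 n x : 0 <= N n x by exact: seminorm_ge0.
have K0 n : 0 <= rho_plus A (N n).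
  rewrite -(pmulr_lge0 _ (norm_neq0 (nN n) e0)).
  exact: le_trans (max_image_ge0 _ _ _) (max_image_le_rho_plus A e (nN n)).
pose K := rho_plus A (N 0%N).
have KN n : rho_plus A (N n) <= K.
  elim: n => // n; apply: le_trans.
  by apply: (rho_plus_relax e0 _ _ (ltW (lam0 n)) (ltW (c0 n))).
have FK n x : F n x <= K * N n x.
  exact: le_trans (max_image_le_rho_plus A x (nN n)) (ler_wpM2r (N0 _ _) (KN n)).
have q0 : 0 <= q.
  by apply: le_trans (qlb 0%N); apply: (rho_minus_ge e0) => // x; rewrite mul0r max_image_ge0.
have [C C0 ecc] := irreducible_eccentricity K irrA.
have {ecc}ecc n x y : N n x * l1norm y <= C * (N n y * l1norm x).
  by apply: ecc => // i z; apply: le_trans (FK n z); exact: max_image_ge.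
have [d d0 pq] : exists2 d, 0 < d & p - d = q + d + 2 * d.
  by exists ((p - q) / 4); [rewrite divr_gt0// subr_gt0|field].
(* A uniform lower bound for the quotient of [lam n + c n * (p - d)] by [lam n + c n * (q + d)]:
   they differ by at least [2 * d * c1], and the latter is at most [1 + c2 * (q + d)]. *)
pose t := 1 + 2 * d * c1 / (1 + c2 * (q + d)).
have B0 : 0 < 1 + c2 * (q + d) by rewrite ltr_pwDl// mulr_ge0 ?(ltW c20)// addr_ge0// ltW.
have t1 : 1 < t by rewrite ltrDl divr_gt0// !mulr_gt0.
have tgrow n : t * (lam n + c n * (q + d)) <= lam n + c n * (p - d).
  have h1 : lam n + c n * (q + d) <= 1 + c2 * (q + d).
    by rewrite lerD// ler_wpM2r// addr_ge0// ltW.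
  have h2 : 2 * d * c1 / (1 + c2 * (q + d)) * (lam n + c n * (q + d))
      <= 2 * d * c1.
    rewrite mulrAC ler_pdivrMr// ler_wpM2l// ?mulr_ge0// ltW//.
  have h3 : d * c1 <= d * c n by rewrite ler_pM2l.
  by rewrite pq /t; lra.
have growth n k x y :
    (forall j, (j <= k)%N -> (p - d) * N (n + j)%N x <= F (n + j)%N x) ->
    (forall j, (j <= k)%N -> F (n + j)%N y <= (q + d) * N (n + j)%N y) ->
    t ^+ k * (N n x * N (n + k)%N y) <= N (n + k)%N x * N n y.
  move=> hx hy; elim: k hx hy => [|k IH] hx hy; first by rewrite addn0 mul1r.
  have {}IH := IH (fun j jk => hx j (leqW jk)) (fun j jk => hy j (leqW jk)).
  have hxk := hx k (leqnSn k); have hyk := hy k (leqnSn k).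
  set j := (n + k)%N in IH hxk hyk *.
  have h1 : N j.+1 y <= (lam j + c j * (q + d)) * N j y.
    by rewrite NE mulrDl -mulrA lerD2l ler_pM2l.
  have h2 : (lam j + c j * (p - d)) * N j x <= N j.+1 x.
    by rewrite NE mulrDl -mulrA lerD2l ler_pM2l.
  have tk : 0 <= t ^+ k by rewrite exprn_ge0//; lra.
  have cp0 : 0 <= lam j + c j * (p - d).
    by rewrite addr_ge0 ?mulr_ge0 ?ltW// pq; lra.
  rewrite addnS -/j exprS.
  apply: (@le_trans _ _ (t * t ^+ k * (N n x * ((lam j + c j * (q + d)) * N j y)))).
    by rewrite ler_wpM2l ?mulr_ge0//; [lra|rewrite ler_wpM2l].
  apply: (@le_trans _ _ ((lam j + c j * (p - d)) * (t ^+ k * (N n x * N j y)))).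
    rewrite [leLHS](_ : _ = t * (lam j + c j * (q + d)) * (t ^+ k * (N n x * N j y)));
      last by ring.
    by rewrite ler_wpM2r// !mulr_ge0.
  apply: (le_trans (ler_wpM2l cp0 IH)).
  by rewrite mulrA ler_wpM2r.
(* The square appears because the eccentricity bound is used at both ends, [n] and [n + k]. *)
have [k Ck] := exprn_unbounded (C * C) t1.
pose L := 1 + 2 * (c2 * K) / l.
have L1 : 1 <= L by rewrite lerDl divr_ge0 ?(ltW l0)// mulr_ge0// mulr_ge0 ?(ltW c20)// K0.
have Lk1 i : 1 <= L ^+ i by rewrite exprn_ege1.
(* Going down from [n + i], each step back replaces the tolerance [b] by [L * b], with [L] the loss
   factor of [relax_back_plus]. *)
have back_plus n i x b : 0 <= b ->
    (forall j, (n <= j)%N -> rho_plus A (N j) <= p + b) ->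
    (p - b) * N (n + i)%N x <= F (n + i)%N x ->
    forall j, (j <= i)%N -> (p - L ^+ i * b) * N (n + j)%N x <= F (n + j)%N x.
  elim: i b => [|i IH] b b0 hb hx j.
    by rewrite leqn0 => /eqP ->; rewrite mul1r.
  have bL : b <= L * b by rewrite ler_peMl.
  rewrite leq_eqVlt => /predU1P[->|].
    apply: le_trans hx; rewrite ler_wpM2r// lerD2l lerN2.
    by rewrite ler_peMl.
  rewrite ltnS exprSr -mulrA; move: j; apply: IH.
  - exact: le_trans bL.
  - by move=> j /hb /le_trans; apply; rewrite lerD2l.
  - apply: (relax_back_plus l0 (lam_ge (n + i)%N) (ltW (c0 _)) (cc2 _) b0) => //.
      exact: K0.
    rewrite addnS NE in hx; apply: (le_trans hx).
    apply: (@max_image_relax_le _ _ _ _ (N (n + i)%N)) => //; [exact: ltW|exact: ltW| |].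
      by apply: le_trans (hb _ (leq_addr i n)).
    move=> y; apply: le_trans (max_image_le_rho_plus A y (nN _)) _.
    by rewrite ler_wpM2r// hb// leq_addr.
have back_minus n i x b : 0 <= b ->
    (forall j, (n <= j)%N -> q - b <= rho_minus A (N j)) ->
    F (n + i)%N x <= (q + b) * N (n + i)%N x ->
    forall j, (j <= i)%N -> F (n + j)%N x <= (q + L ^+ i * b) * N (n + j)%N x.
  elim: i b => [|i IH] b b0 hb hx j.
    by rewrite leqn0 => /eqP ->; rewrite mul1r.
  have bL : b <= L * b by rewrite ler_peMl.
  rewrite leq_eqVlt => /predU1P[->|].
    apply: (le_trans hx); rewrite ler_wpM2r// lerD2l.
    by rewrite ler_peMl.
  rewrite ltnS exprSr -mulrA; move: j; apply: IH.
  - exact: le_trans bL.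
  - by move=> j /hb; apply: le_trans; rewrite lerD2l lerN2.
  - apply: (relax_back_minus l0 (lam_ge (n + i)%N) (ltW (c0 _)) (cc2 _) b0) => //.
      exact: K0.
    rewrite addnS NE in hx; apply: le_trans hx.
    apply: (@max_image_relax_ge _ _ _ _ (N (n + i)%N)) => //; first exact: ltW.
    move=> y; apply: le_trans (max_image_ge_rho_minus A y (nN _)).
    by rewrite ler_wpM2r// hb// leq_addr.
(* After [k] steps back this tolerance has grown to [d]. *)
pose b := d / L ^+ k.
have b0 : 0 < b by rewrite divr_gt0// (lt_le_trans ltr01).
have Lb : L ^+ k * b = d by rewrite /b mulrC divfK// gt_eqF// (lt_le_trans ltr01).
have [n [pn qn]] : exists n, (forall j, (n <= j)%N -> rho_plus A (N j) <= p + b)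
    /\ (forall j, (n <= j)%N -> q - b <= rho_minus A (N j)).
  have [n1 _ h1] := cvg_near_dist pcvg b0.
  have [n2 _ h2] := cvg_near_dist qcvg b0.
  exists (maxn n1 n2); split=> j; rewrite geq_max => /andP[j1 j2].
    by have := h1 j j1; rewrite /= ler_norml => /andP[_]; lra.
  by have := h2 j j2; rewrite /= ler_norml => /andP[+ _]; lra.
have [x x0 hx] := rho_plus_adherent A e0 (nN (n + k)%N) b0.
have [y y0 hy] := rho_minus_adherent A e0 (nN (n + k)%N) b0.
have {hx}hx : (p - b) * N (n + k)%N x <= F (n + k)%N x.
  by apply: le_trans hx; rewrite ler_wpM2r// lerD2r.
have {hy}hy : F (n + k)%N y <= (q + b) * N (n + k)%N y.
  by apply: (le_trans hy); rewrite ler_wpM2r// lerD2r.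
have := back_plus n k x b (ltW b0) pn hx; rewrite Lb => hx'.
have := back_minus n k y b (ltW b0) qn hy; rewrite Lb => hy'.
have G := growth n k x y hx' hy'.
have e1 := ecc (n + k)%N x y; have e2 := ecc n y x.
have Sx := l1norm_gt0 x0; have Sy := l1norm_gt0 y0.
have Nx := norm_neq0 (nN n) x0; have Ny := norm_neq0 (nN (n + k)%N) y0.
have : t ^+ k * (N n x * N (n + k)%N y) * (l1norm x * l1norm y) <=
    C * C * (N n x * N (n + k)%N y) * (l1norm x * l1norm y).
  apply: (@le_trans _ _ (N (n + k)%N x * N n y * (l1norm x * l1norm y))).
    by rewrite ler_wpM2r// mulr_ge0// ltW.
  rewrite [leLHS](_ : _ = (N (n + k)%N x * l1norm y) * (N n y * l1norm x)); last by ring.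
  rewrite [leRHS](_ : _ = (C * (N (n + k)%N y * l1norm x)) * (C * (N n x * l1norm y)));
    last by ring.
  by rewrite ler_pM// mulr_ge0// ltW.
by rewrite ler_pM2r ?mulr_gt0// ler_pM2r ?mulr_gt0// leNgt Ck.
Qed.

(** * Convergence of the norms to a Barabanov norm *)

(** The distortion bound is applied to [A i *m x] and [A j *m y], with [i] maximal for [N] at [x]
    and [j] maximal for [Q] at [y]; the factor [rho] then cancels, so [max_image A N] inherits the
    bound. *)
Lemma relax_ratio_step (R : realType) (m r : nat) (A : 'I_r -> 'M[R]_m)
    (N Q : 'cV[R]_m -> R) (l c q rho : R) :
  (0 < r)%N -> is_norm N -> is_barabanov A rho Q -> 0 < rho ->
  0 <= l -> 0 <= c -> 0 <= q ->
  (forall x y, N x * Q y <= q * (N y * Q x)) ->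
  forall x y, (l * N x + c * max_image A N x) * Q y <=
    q * ((l * N y + c * max_image A N y) * Q x).
Proof.
move=> r0 nN [nQ QA] rho0 l0 c0 q0 NQ x y.
have sN := norm_seminorm nN; have sQ := norm_seminorm nQ.
have FQ : max_image A N x * Q y <= q * (max_image A N y * Q x).
  have [i ->] := max_image_attained A x r0 sN.
  have [j Qj] := max_image_attained A y r0 sQ; rewrite QA in Qj.
  rewrite -(ler_pM2l rho0) mulrCA Qj (le_trans (NQ _ _))//.
  rewrite [leRHS](_ : _ = q * (max_image A N y * (rho * Q x))); last by ring.
  rewrite ler_wpM2l// ler_pM ?seminorm_ge0 ?max_image_ge//.
  by rewrite -QA max_image_ge.
rewrite !mulrDl mulrDr lerD//.
  rewrite [leRHS](_ : _ = l * (q * (N y * Q x))); last by ring.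
  by rewrite -mulrA ler_wpM2l.
rewrite [leRHS](_ : _ = c * (q * (max_image A N y * Q x))); last by ring.
by rewrite -mulrA ler_wpM2l.
Qed.

(* The limit is first taken along an ultrafilter; the ratio to the resulting
   Barabanov norm contracts along the whole sequence. *)
Lemma relax_cvg_barabanov (R : realType) (m r : nat) (A : 'I_r -> 'M[R]_m)
    (N : nat -> 'cV[R]_m -> R) (lam c : nat -> R) (e : 'cV[R]_m) (rho : R) :
  irreducible_family A -> (0 < r)%N -> e != 0 -> 0 < rho ->
  (forall n, is_norm (N n)) -> (forall n, N n e = 1) ->
  (forall n x, N n.+1 x = lam n * N n x + c n * max_image A (N n) x) ->
  (forall n, 0 <= lam n) -> (forall n, 0 <= c n) ->
  (forall n, rho_plus A (N n) <= rho_plus A (N 0%N)) ->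
  rho_plus A (N n) @[n --> \oo] --> rho ->
  rho_minus A (N n) @[n --> \oo] --> rho ->
  exists Q : 'cV[R]_m -> R,
    (forall x, N n x @[n --> \oo] --> Q x) /\ is_barabanov A rho Q.
Proof.
move=> irrA r0 e0 rho0 nN Ne NE lam0 c0 pub pcvg qcvg.
have sN n := norm_seminorm (nN n).
have N0 n x : 0 <= N n x by exact: seminorm_ge0.
have [C C0 ecc] := irreducible_eccentricity (rho_plus A (N 0%N)) irrA.
have {}ecc n x y : N n x * l1norm y <= C * (N n y * l1norm x).
  apply: ecc => // i z; apply: le_trans (max_image_ge A (N n) i z) _.
  exact: le_trans (max_image_le_rho_plus A z (nN n)) (ler_wpM2r (N0 _ _) (pub n)).
have Se := l1norm_gt0 e0.
(* The normalisation at [e] turns bounded eccentricity into two-sided bounds uniform in [n]; the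
   lower one keeps the limit definite. *)
have NB n x : N n x <= C / l1norm e * l1norm x.
  by rewrite mulrAC ler_pdivlMr// -[l1norm x]mul1r -(Ne n) ecc.
have NL n x : (C * l1norm e)^-1 * l1norm x <= N n x.
  rewrite ler_pdivrMl ?mulr_gt0// -[leLHS]mul1r -(Ne n) (le_trans (ecc n e x))//.
  by rewrite -mulrA ler_pM2l// mulrC.
have [U [UU ooU]] := exists_ultra_eventually.
have PU := @ultra_proper _ _ UU.
have [Q [sQ QB NQ]] := seminorm_ultra_limit UU sN NB.
have NQu := seminorm_cvg_uniform UU sN NB sQ QB NQ.
have QL x : (C * l1norm e)^-1 * l1norm x <= Q x.
  by apply: (cvgr_to_ge (NQ x)); exact: filterE.
have nQ : is_norm Q.
  split; [|exact: sQ.1|exact: sQ.2] => x x0; apply: lt_le_trans (QL x).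
  by rewrite mulr_gt0 ?invr_gt0 ?mulr_gt0// l1norm_gt0.
have Qe : Q e = 1.
  apply: (@cvg_unique _ _ _ _ _ _ (NQ e)) => //.
  by rewrite (_ : (fun n => _) = cst 1); [exact: cvg_cst|apply/funext].
have pU : rho_plus A (N n) @[n --> U] --> rho by move=> V /pcvg; exact: ooU.
have qU : rho_minus A (N n) @[n --> U] --> rho by move=> V /qcvg; exact: ooU.
have bQ : is_barabanov A rho Q.
  split=> // x; apply/eqP; rewrite eq_le; apply/andP; split.
    apply: max_image_le => [|i]; first by rewrite mulr_ge0 ?seminorm_ge0// ltW.
    have pN : rho_plus A (N n) * N n x @[n --> U] --> rho * Q x.
      by apply: cvgM; [exact: pU|exact: NQ].
    apply: (ler_cvg_to (NQ _) pN); apply: filterE => n.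
    exact: le_trans (max_image_ge A (N n) i x) (max_image_le_rho_plus A x (nN n)).
  apply/ler_addgt0Pr => d d0.
  have qN : rho_minus A (N n) * N n x @[n --> U] --> rho * Q x.
    by apply: cvgM; [exact: qU|exact: NQ].
  apply: (cvgr_to_le qN).
  (* The maximising index varies with [n], so closeness is required at all the finitely many images
     at once. *)
  have : \forall n \near U, forall i, `|N n (A i *m x) - Q (A i *m x)| <= d.
    by apply: filter_forall => i; exact: cvg_near_dist (NQ _) _ d0.
  apply: filterS => n Nd.
  apply: (le_trans (max_image_ge_rho_minus A x (nN n))).
  have [i ->] := max_image_attained A x r0 (sN n).
  have := Nd i; rewrite ler_norml => /andP[_ h].
  by have := max_image_ge A Q i x; lra.
exists Q; split=> // x.
have near1 a : 0 < a -> a <= 1 ->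
    exists n, forall x y, N n x * Q y <= (1 + a) * (N n y * Q x).
  move=> a0 a1.
  have k0 : 0 < (C * l1norm e)^-1 by rewrite invr_gt0 mulr_gt0.
  (* By [QL] this error relative to [l1norm] is at most [a / 3] relative to [Q]; a third suffices,
     as [1 + a / 3 <= (1 + a) * (1 - a / 3)] for [a <= 1]. *)
  have d0 : 0 < a / 3 * (C * l1norm e)^-1 by rewrite mulr_gt0// divr_gt0.
  have [n Nn] := filter_ex (NQu _ d0).
  have close z : (1 - a / 3) * Q z <= N n z /\ N n z <= (1 + a / 3) * Q z.
    have h1 : a / 3 * ((C * l1norm e)^-1 * l1norm z) <= a / 3 * Q z.
      by rewrite ler_wpM2l// ltW// divr_gt0.
    have := Nn z; rewrite -mulrA ler_norml => /andP[h2 h3].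
    by split; lra.
  exists n => x1 y1.
  have Qx : 0 <= Q x1 by exact: seminorm_ge0.
  have Qy : 0 <= Q y1 by exact: seminorm_ge0.
  apply: (@le_trans _ _ ((1 + a / 3) * (Q x1 * Q y1))).
    by rewrite mulrA ler_wpM2r//; case: (close x1).
  apply: (@le_trans _ _ ((1 + a) * ((1 - a / 3) * (Q x1 * Q y1)))).
    rewrite [leRHS]mulrA ler_wpM2r ?mulr_ge0//.
    have : a * a <= a by rewrite ler_piMl// ltW.
    by lra.
  rewrite ler_wpM2l ?addr_ge0 ?(ltW a0)//.
  rewrite [leLHS](_ : _ = (1 - a / 3) * Q y1 * Q x1); last by ring.
  by rewrite ler_wpM2r//; case: (close y1).
apply/cvgrPdist_le => d d0.
have Qx : 0 <= Q x by exact: seminorm_ge0.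
pose a := Num.min 1 (d / (2 * (Q x + 1))).
have B0 : 0 < 2 * (Q x + 1) by rewrite mulr_gt0// ltr_wpDl.
have a0 : 0 < a by rewrite lt_min ltr01 divr_gt0.
have a1 : a <= 1 by rewrite ge_min lexx.
have aQ : a * (2 * (Q x + 1)) <= d by rewrite -ler_pdivlMr// ge_min lexx orbT.
have [n Nn] := near1 a a0 a1.
have a10 : 0 <= 1 + a by rewrite addr_ge0// ltW.
have Nk k : forall x y, N (n + k)%N x * Q y <= (1 + a) * (N (n + k)%N y * Q x).
  elim: k => [|k IH]; first by rewrite addn0.
  move=> x1 y1; rewrite addnS !NE.
  exact: (relax_ratio_step r0 (nN _) bQ rho0 (lam0 _) (c0 _) a10 IH).
exists n => // j /= nj; rewrite -(subnKC nj).
(* Both norms are 1 at [e], so comparison with [e] turns the distortion bound into bounds on the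
   values at [x]. *)
have := Nk (j - n)%N x e; have := Nk (j - n)%N e x.
rewrite Ne Qe !mulr1 !mul1r => h1 h2.
set z := N _ x in h1 h2 *.
have h3 : a * z <= a * ((1 + a) * Q x) by rewrite ler_pM2l.
have h4 : a * (a * Q x) <= a * Q x.
  by rewrite ler_pM2l// ler_piMl.
by rewrite ler_norml; apply/andP; split; lra.
Qed.

(** * Monotone ratios of the relaxed norms and identification of their limit *)

Theorem mainTheorem1 (R : realType) (m r : nat) (A : 'I_r -> 'M[R]_m)
    (r_gt0 : (0 < r)%N)
    (irrA : irreducible_family A)
    (nondegA : ~ (m = 1%N /\ forall i, A i = 0))
    (nu : 'cV[R]_m -> R) (nu_norm : is_norm nu)
    (N0 : 'cV[R]_m -> R) (N0_norm : is_norm N0)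
    (e : 'cV[R]_m) (e_unit : N0 e = 1)
    (lminus lplus : R) (lminus_gt0 : 0 < lminus)
    (lminus_le_lplus : lminus <= lplus) (lplus_lt1 : lplus < 1)
    (lam : nat -> R) (lam_bounds : forall n, lminus <= lam n <= lplus) :
  [/\ rho_plus A (relax A e lam N0 n) @[n --> \oo] --> jsr nu A,
      rho_minus A (relax A e lam N0 n) @[n --> \oo] --> jsr nu A
    & exists Nstar : 'cV[R]_m -> R,
        (forall x, relax A e lam N0 n x @[n --> \oo] --> Nstar x) /\
        is_barabanov A (jsr nu A) Nstar].
Proof.
have e0 : e != 0.
  apply: contra_eq_neq e_unit => ->.
  by rewrite (seminorm0 (norm_seminorm N0_norm)) eq_sym oner_neq0.
set N := relax A e lam N0.
pose gamma n := max_image A (N n) e.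
pose c n := (1 - lam n) * (gamma n)^-1.
have NE n x : N n.+1 x = lam n * N n x + c n * max_image A (N n) x by [].
have lam0 n : 0 < lam n by case/andP: (lam_bounds n) => ? _; lra.
have lam1 n : lam n < 1 by case/andP: (lam_bounds n) => _ ?; lra.
(* Positivity of [gamma n], which needs [N n] to be a norm, also yields the normalisation at
   [n.+1]. *)
have [nN Ne] : (forall n, is_norm (N n)) /\ (forall n, N n e = 1).
  apply/all_and2; elim=> [//|n [nNn Nne]].
  have g0 : 0 < gamma n := norm_neq0 (max_image_norm irrA nondegA nNn) e0.
  split.
    apply: (relax_step_norm A nNn (lam0 n)).
    by rewrite mulr_ge0 ?invr_ge0 ?ltW// subr_gt0.
  by rewrite NE Nne mulr1 /c -mulrA mulVf ?gt_eqF// mulr1 addrC subrK.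
have g0 n : 0 < gamma n := norm_neq0 (max_image_norm irrA nondegA (nN n)) e0.
have c0 n : 0 < c n by rewrite mulr_gt0 ?invr_gt0// subr_gt0.
have pS n : rho_plus A (N n.+1) <= rho_plus A (N n).
  exact: (rho_plus_relax e0 (nN n) (nN n.+1) (ltW (lam0 n)) (ltW (c0 n))).
have qS n : rho_minus A (N n) <= rho_minus A (N n.+1).
  exact: (rho_minus_relax r_gt0 e0 (nN n) (nN n.+1) (ltW (lam0 n)) (ltW (c0 n))).
have p_dec : nonincreasing_seq (fun n => rho_plus A (N n)).
  exact/nonincreasing_seqP.
have q_inc : nondecreasing_seq (fun n => rho_minus A (N n)).
  exact/nondecreasing_seqP.
have qg n : rho_minus A (N n) <= gamma n.
  by have := max_image_ge_rho_minus A e (nN n); rewrite Ne mulr1.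
have gp n : gamma n <= rho_plus A (N n).
  by have := max_image_le_rho_plus A e (nN n); rewrite Ne mulr1.
have q00 : 0 < rho_minus A (N 0%N).
  have [K K0 NK] := seminorm_le_norm (norm_seminorm (nN 0%N))
    (max_image_norm irrA nondegA (nN 0%N)).
  apply: (@lt_le_trans _ _ K^-1); first by rewrite invr_gt0.
  by apply: (rho_minus_ge e0) => // x; rewrite ler_pdivrMl.
set q0 := rho_minus A (N 0%N) in q00; pose p0 := rho_plus A (N 0%N).
have qp n k : rho_minus A (N n) <= rho_plus A (N k).
  apply: (@le_trans _ _ (rho_minus A (N (maxn n k)))).
    exact: q_inc (leq_maxl _ _).
  apply: le_trans (p_dec _ _ (leq_maxr n k)).
  exact: le_trans (qg _) (gp _).
have p00 : 0 < p0 by exact: lt_le_trans (qp 0%N 0%N).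
have pcv : cvgn (fun n => rho_plus A (N n)).
  apply: nonincreasing_is_cvgn => //.
  by exists q0 => _ [n _ <-]; exact: qp.
have qcv : cvgn (fun n => rho_minus A (N n)).
  apply: nondecreasing_is_cvgn => //.
  by exists p0 => _ [n _ <-]; exact: qp.
have [p pcvg] := (cvg_ex _).1 pcv; have [q qcvg] := (cvg_ex _).1 qcv.
have pub n : p <= rho_plus A (N n).
  rewrite -(cvg_lim _ pcvg)//; exact: nonincreasing_cvgn_ge.
have qlb n : rho_minus A (N n) <= q.
  rewrite -(cvg_lim _ qcvg)//; exact: nondecreasing_cvgn_le.
have pq : p = q.
  apply/eqP; rewrite eq_le; apply/andP; split; last first.
    by apply: (ler_cvg_to qcvg pcvg); apply: nearW => n; exact: qp.
  (* The bounds on [c n] come from [q0 <= gamma n <= p0], as [gamma n] is the ratio at [e] and both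
     extremal ratios are monotone. *)
  apply: (@cvg_gap_closed _ _ _ A N lam c e lminus ((1 - lplus) / p0) q0^-1) => //.
  - by move=> n; case/andP: (lam_bounds n) => -> _; exact: ltW.
  - by rewrite divr_gt0// subr_gt0.
  - move=> n; have [_ ll] := andP (lam_bounds n); apply/andP; split.
      apply: ler_pM; rewrite ?invr_ge0 ?subr_ge0 ?(ltW lplus_lt1) ?(ltW p00)//.
        by rewrite lerD2l lerN2.
      rewrite lef_pV2 ?posrE//; apply: (le_trans (gp n)).
      exact: p_dec (leq0n n).
    rewrite -[leRHS]mul1r; apply: ler_pM;
      rewrite ?invr_ge0 ?subr_ge0 ?(ltW (lam1 n)) ?(ltW (g0 n))//.
      by rewrite lerBlDr lerDl ltW.
    rewrite lef_pV2 ?posrE//; apply: le_trans (qg n).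
    exact: q_inc (leq0n n).
rewrite -pq in qcvg.
have p_gt0 : 0 < p by rewrite pq; exact: lt_le_trans (qlb 0%N).
have [Q [NQ bQ]] := relax_cvg_barabanov irrA r_gt0 e0 p_gt0 nN Ne NE
  (fun n => ltW (lam0 n)) (fun n => ltW (c0 n)) (fun n => p_dec _ _ (leq0n n))
  pcvg qcvg.
rewrite (jsr_barabanov r_gt0 e0 p_gt0 nu_norm bQ).
by split=> //; exists Q.
Qed.
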